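(* Let $N$ be a prime, let $f$ be an integer with $1<f<N-1$, let $f'$ be the integer with $1\le f'<N$ and $ff'\equiv 1\pmod N$, and put $r=(ff'-1)/N$. Then $[\mathcal{X}(N,r,f)]>0$.
   Context: For integers $N,r\ge 1$ and a positive divisor $f$ of $Nr+1$, define $$\mathcal{X}(N,r,f)=\Big\{(a+b)-\Big(f+\tfrac{Nr+1}{f}\Big): a,b \text{ positive integers with } ab=Nr\Big\},$$ a finite set of integers. The notation $[\mathcal{X}(N,r,f)]>0$ means that every element of $\mathcal{X}(N,r,f)$ is a positive integer. *)

(* Defs.v *)
From mathcomp Require Import all_boot all_order all_algebra.
From mathcomp Require Import classical_sets.
Set Implicit Arguments.
Unset Strict Implicit.
Unset Printing Implicit Defensive.
Import Order.TTheory GRing.Theory Num.Theory.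
Local Open Scope ring_scope.
Local Open Scope classical_set_scope.

(* Meant for N, r, f >= 1 with f %| N * r + 1, in which case the division is
   exact. The subtraction takes place in int. *)
Definition calX (N r f : nat) : set int :=
  [set x : int | exists a b : nat,
     [/\ (0 < a)%N, (0 < b)%N, (a * b = N * r)%N &
         x = (a%:Z + b%:Z) - (f%:Z + ((N * r + 1) %/ f)%N%:Z)]].

(* The relation written [S] > 0. It holds vacuously for the empty set, but
   calX N r f is nonempty when N, r >= 1 (take a = N and b = r). *)
Definition all_positive (S : set int) : Prop := forall x : int, S x -> 0 < x.

(* Main.v *)
Require Import Defs.
From mathcomp Require Import all_boot all_order all_algebra.
From mathcomp Require Import classical_sets.
From mathcomp Require Import zify.

(** Since [a * b = N * r = f * f' - 1], the prime [N] divides [a] or [b], say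
    [a], so that [a >= N] exceeds both [f] and [f'], and exceeds [f] by at
    least 2.  If [a + b <= f + f'], then
    [(a - f) * (a - f') = a^2 - a * (f + f') + a * b + 1 <= 1],
    whereas the left-hand side is at least 2. *)

Lemma add_lt_add_of_mul_succ (a b f f' : nat) :
  (f.+1 < a)%N -> (f' < a)%N -> (a * b).+1 = (f * f')%N ->
  (f + f' < a + b)%N.
Proof.
move=> lt_fa lt_f'a ab1; rewrite ltnNge; apply/negP => le_ab.
(* The gaps [x.+2] and [y.+1] stand for [a - f] and [a - f'], so that no truncated subtraction
   enters the algebra; their product is visibly at least 2. *)
have [x def_a] : exists x, a = (f + x.+2)%N by exists (a - f.+2)%N; lia.
have [y def_a'] : exists y, a = (f' + y.+1)%N by exists (a - f'.+1)%N; lia.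
have le_a2 : (a * (a + b) <= a * (f + f'))%N by rewrite leq_mul2l le_ab orbT.
have prod_eq : (x.+2 * y.+1 + a * (f + f') = a * a + f * f')%N by nia.
(* With [le_a2] and [ab1], the identity [prod_eq] would force [x.+2 * y.+1 <= 1]. *)
nia.
Qed.

Theorem mainTheorem2 (N f f' r : nat)
    (hN : prime N)
    (hf : (1 < f)%N /\ (f < N - 1)%N)
    (hf' : (1 <= f')%N /\ (f' < N)%N)
    (hff' : f * f' = 1 %[mod N])
    (hr : r = ((f * f' - 1) %/ N)%N) :
  all_positive (calX N r f).
Proof.
case: hf hf' => f_gt1 lt_fN [f'_gt0 lt_f'N].
have ff'_gt0 : (0 < f * f')%N by rewrite muln_gt0 f'_gt0 andbT ltnW.
have N_dvd : (N %| f * f' - 1)%N by rewrite -eqn_mod_dvd //; apply/eqP.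
have Nr : (N * r = f * f' - 1)%N by rewrite hr mulnC divnK.
move=> _ [a [b [a_gt0 b_gt0 abNr ->]]].
(* Since [N * r + 1 = f * f'], the quotient in [calX] is exactly [f']. *)
rewrite Nr subnK // mulKn; last exact: ltnW.
have ab1 : (a * b).+1 = (f * f')%N by lia.
suff : (f + f' < a + b)%N by lia.
have : (N %| a * b)%N by rewrite abNr dvdn_mulr.
rewrite Euclid_dvdM // => /orP[/(dvdn_leq a_gt0)|/(dvdn_leq b_gt0)] le_N.
  by apply: add_lt_add_of_mul_succ => //; lia.
by rewrite [(a + b)%N]addnC; apply: add_lt_add_of_mul_succ; lia.
Qed.
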